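(* Let $q$ be a prime power, $k\ge 1$, and let $\mathfrak m,\mathfrak n$ be $k$-tuples of nonnegative integers. Then $$P_k(\mathfrak m;\mathfrak n)=\sum_{\substack{\mathfrak d\ge\mathfrak 0\\ \mathfrak d\le\mathfrak m,\ \mathfrak d\le\mathfrak n}}N_k(\mathfrak m-\mathfrak d)N_k(\mathfrak n-\mathfrak d)A_k(\mathfrak d),$$ where $$A_k(\mathfrak d)=\sum_{h\in\mathcal N_k(\mathfrak d)}\mu(h)=\sum_{(a_{\mathfrak i})}(-1)^{\sum_{\mathfrak i}a_{\mathfrak i}}\prod_{\mathfrak 0<\mathfrak i\le\mathfrak d}\binom{I_k(\mathfrak i)}{a_{\mathfrak i}},$$ the last sum being over all families $(a_{\mathfrak i})_{\mathfrak 0<\mathfrak i\le\mathfrak d}$ of nonnegative integers with $\sum_{\mathfrak 0<\mathfrak i\le\mathfrak d}a_{\mathfrak i}\mathfrak i=\mathfrak d$.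
   Context: $\mathbb F_q$ is the finite field with $q$ elements. Two polynomials in $\mathbb F_q[x_1,\dots,x_k]$ are identified if they differ by a factor in $\mathbb F_q^\times$; the classes are called normalized polynomials. The vector degree of a nonzero $f$ is $\operatorname{Deg} f=(\deg_{x_1}f,\dots,\deg_{x_k}f)$. $k$-tuples of nonnegative integers are ordered componentwise, $\mathfrak 0$ is the zero tuple, and $\mathfrak a<\mathfrak b$ means $\mathfrak a\le\mathfrak b$ and $\mathfrak a\ne\mathfrak b$. $\mathcal N_k(\mathfrak m)$ is the set of normalized polynomials $f\in\mathbb F_q[x_1,\dots,x_k]$ with $\operatorname{Deg} f=\mathfrak m$, $N_k(\mathfrak m)=|\mathcal N_k(\mathfrak m)|$, and $I_k(\mathfrak m)$ is the number of irreducible elements of $\mathcal N_k(\mathfrak m)$. $P_k(\mathfrak m;\mathfrak n)=|\{(f,g)\in\mathcal N_k(\mathfrak m)\times\mathcal N_k(\mathfrak n):\gcd(f,g)=1\}|$. The Möbius function $\mu$ on nonzero normalized polynomials is $\mu(h)=(-1)^s$ if $h$ is a product of $s$ distinct irreducibles, and $\mu(h)=0$ if $h$ is divisible by the square of an irreducible. *)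

(* Defs.v *)
From mathcomp Require Import all_boot all_order all_algebra.
From mathcomp Require Import generic_quotient finmap mpoly.
From mathcomp Require Import boolp classical_sets functions cardinality.

Set Implicit Arguments.
Unset Strict Implicit.
Unset Printing Implicit Defensive.

Import GRing.Theory.

Local Open Scope ring_scope.
Local Open Scope quotient_scope.
Local Open Scope classical_set_scope.

Section NormalizedPolynomials.
Variables (F : finFieldType) (k : nat).

Implicit Types (p q d : {mpoly F[k]}).

Definition assoc p q : bool := [exists c : F, (c != 0) && (p == c *: q)].

Lemma assocP p q : reflect (exists2 c : F, c != 0 & p = c *: q) (assoc p q).
Proof.
apply: (iffP existsP) => [[c /andP[c0 /eqP ->]]|[c c0 ->]]; exists c => //.
by rewrite c0 eqxx.
Qed.

Lemma assoc_refl : reflexive assoc.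
Proof. by move=> p; apply/assocP; exists 1; rewrite ?oner_eq0 ?scale1r. Qed.

Lemma assoc_sym : ssrbool.symmetric assoc.
Proof.
have sub p q : assoc p q -> assoc q p.
  case/assocP=> c c0 ->; apply/assocP; exists c^-1; rewrite ?invr_eq0 //.
  by rewrite scalerA mulVf // scale1r.
by move=> p q; apply/idP/idP; apply: sub.
Qed.

Lemma assoc_trans : transitive assoc.
Proof.
move=> q p r /assocP[c c0 ->] /assocP[e e0 ->]; apply/assocP; exists (c * e).
  by rewrite mulf_neq0.
by rewrite scalerA.
Qed.

Canonical assoc_equiv := EquivRel assoc assoc_refl assoc_sym assoc_trans.

Definition normpoly := {eq_quot assoc_equiv}.

Definition multideg p : 'X_{1..k} :=
  [multinom (\max_(t <- msupp p) t i)%N | i < k].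

Definition mdvd p q : Prop := exists r, q = r * p.

Definition is_gcd d p q : Prop :=
  [/\ mdvd d p, mdvd d q & forall e, mdvd e p -> mdvd e q -> mdvd e d].

Definition mirreducible p : Prop :=
  [/\ p != 0, p \isn't a GRing.unit &
    forall q r, p = q * r -> q \is a GRing.unit \/ r \is a GRing.unit].

Lemma multidegZ (c : F) p : c != 0 -> multideg (c *: p) = multideg p.
Proof.
move=> c0; apply/mnmP => i; rewrite !mnmE.
by apply: perm_big; apply: msuppZ.
Qed.

Lemma mdvdZl (c : F) p q : c != 0 -> mdvd (c *: p) q <-> mdvd p q.
Proof.
move=> c0; split=> -[r ->].
  by exists (c *: r); rewrite -scalerAr scalerAl.
by exists (c^-1 *: r); rewrite -scalerAl -scalerAr scalerA mulVf // scale1r.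
Qed.

Lemma mdvdZr (c : F) p q : c != 0 -> mdvd p (c *: q) <-> mdvd p q.
Proof.
move=> c0; split=> -[r e]; last by exists (c *: r); rewrite e scalerAl.
by exists (c^-1 *: r); rewrite -scalerAl -e scalerA mulVf // scale1r.
Qed.

Lemma unitZ (c : F) p :
  c != 0 -> ((c *: p) \is a GRing.unit) = (p \is a GRing.unit).
Proof.
move=> c0; rewrite -mul_mpolyC unitrM andb_idl // => _.
by apply/unitrP; exists c^-1%:MP; rewrite -!mpolyCM mulVf ?mulfV.
Qed.

Lemma mirreducibleZ (c : F) p :
  c != 0 -> mirreducible (c *: p) <-> mirreducible p.
Proof.
have sub (e : F) q : e != 0 -> mirreducible q -> mirreducible (e *: q).
  move=> e0 [q0 qU irr]; split; rewrite ?scaler_eq0 ?negb_or ?e0 ?unitZ //.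
  move=> r s E; have/irr : q = (e^-1 *: r) * s.
    by rewrite -scalerAl -E scalerA mulVf // scale1r.
  by rewrite unitZ ?invr_eq0.
move=> c0; split; last exact: sub.
move/(sub c^-1); rewrite invr_eq0 => /(_ c0).
by rewrite scalerA mulVf // scale1r.
Qed.

Lemma repr_pi p :
  exists2 c : F, c != 0 & repr (\pi_normpoly p) = c *: p.
Proof. by apply/assocP; have/eqmodP := reprK (\pi_normpoly p). Qed.

(* Degree, divisibility, gcd and irreducibility do not change under nonzero
   scalar factors, so they are read off the representative [repr f] of a class
   [f]. The class of a product is [\pi] of the product of representatives. *)
Implicit Types (f g h : normpoly) (m n : 'X_{1..k}).

Definition normset m : set normpoly :=
  [set f | repr f != 0 /\ multideg (repr f) = m].

Lemma finite_normset m : finite_set (normset m).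
Proof.
pose P (c : {ffun 'X_{1..k < (mdeg m).+1} -> F}) : normpoly :=
  \pi_normpoly (\sum_t c t *: 'X_[t]).
apply: (@sub_finite_set _ _ (P @` setT)); last exact/finite_image/finite_finset.
move=> f [f0 Df]; exists [ffun t : 'X_{1..k < (mdeg m).+1} => (repr f)@_t] => //.
rewrite /P -[RHS]reprK; congr (\pi _).
under eq_bigr do rewrite ffunE.
rewrite -mpolywE // msizeE; apply/bigmax_leqP_seq => t tf _.
rewrite ltnS !mdegE leq_sum // => i _.
by rewrite -Df mnmE; apply: leq_bigmax_seq.
Qed.

Definition Npoly m : nat := #|` fset_set (normset m)|.

Definition Ipoly m : nat :=
  #|` fset_set (normset m `&` [set f | mirreducible (repr f)])|.

Definition Pcoprime m n : nat :=
  #|` fset_set [set fg : normpoly * normpoly |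
        [/\ normset m fg.1, normset n fg.2 &
            is_gcd 1 (repr fg.1) (repr fg.2)]]|.

Definition prod_distinct_irr h (s : nat) : Prop :=
  exists S : {fset normpoly},
    [/\ forall f, f \in S -> mirreducible (repr f), #|` S| = s &
        h = \pi_normpoly (\prod_(f <- S) repr f)].

(* For nonzero [h] not divisible by the square of an irreducible, unique
   factorization gives exactly one [s] with [prod_distinct_irr h s]. *)
Definition mobius h : int :=
  if `[< exists2 p : {mpoly F[k]}, mirreducible p & mdvd (p ^+ 2) (repr h) >]
  then 0 else (-1) ^+ xget 0%N [set s | prod_distinct_irr h s].

Definition Apoly m : int := \sum_(h <- fset_set (normset m)) mobius h.

End NormalizedPolynomials.

Section Families.
Variables (k : nat).
Implicit Types (m : 'X_{1..k}).

(* A family indexed by the tuples 0 < i <= m; every i <= m has total degree at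
   most that of m, so the bound on total degree excludes nothing. *)
Definition below m :=
  {i : 'X_{1..k < (mdeg m).+1} | (0 < bmnm i)%MM && (bmnm i <= m)%MM}.

Definition below_mnm m (i : below m) : 'X_{1..k} := bmnm (val i).

Definition families m : set {ffun below m -> nat} :=
  [set a | (\sum_(i : below m) below_mnm i *+ a i)%MM = m].
Arguments families : clear implicits.

Lemma finite_families m : finite_set (families m).
Proof.
pose P (b : {ffun below m -> 'I_(mdeg m).+1}) := [ffun i => nat_of_ord (b i)].
apply: (@sub_finite_set _ _ (P @` setT)); last exact/finite_image/finite_finset.
move=> a Ea.
have le_a i : (a i < (mdeg m).+1)%N.
  have /andP[/andP[i0 _] _] := valP i.
  rewrite ltnS -[X in (_ <= mdeg X)%N]Ea mdeg_sum (bigD1 i) //= mdegMn.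
  apply: leq_trans (leq_addr _ _); apply: leq_pmull.
  by rewrite lt0n mdeg_eq0 eq_sym.
by exists [ffun i => Ordinal (le_a i)] => //; apply/ffunP => i; rewrite !ffunE.
Qed.

End Families.

Arguments families {k} m.

(* Main.v *)
Require Import Defs.
From mathcomp Require Import all_boot all_order all_algebra.
From mathcomp Require Import generic_quotient finmap mpoly.
From mathcomp Require Import boolp classical_sets functions cardinality.

(* F[x_1, ..., x_k] is factorial (Gauss's lemma, by induction on k), so a
   squarefree normalized polynomial is the same thing as a finite set of
   irreducible ones, with Mobius value (-1)^(cardinality). Hence the sum of mu
   over the common divisors of f and g is the signed count of all subsets of
   their set of common irreducible divisors, that is 1 if f and g are coprime
   and 0 otherwise. Summing over all pairs (f, g) and collecting the pairs
   divisible by h gives the first formula, since the multiples of h of degree m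
   are h times the polynomials of degree m - deg h. The second formula sorts the
   finite sets of irreducibles according to the number a_i of members of each
   degree i. *)

Set Implicit Arguments.
Unset Strict Implicit.
Unset Printing Implicit Defensive.

Import GRing.Theory.

Local Open Scope ring_scope.
Local Open Scope quotient_scope.

(** * Factorial domains *)

Section Factoriality.
Variable R : idomainType.
Implicit Types (a b c p q : R) (s : seq R).

(** On [{mpoly F[k]}] this is convertible to [mdvd], so the lemmas below apply to [mdvd] goals
    directly. *)
Definition divides a b : Prop := exists c, b = c * a.

Definition prime_elt p : Prop :=
  [/\ p != 0, p \isn't a GRing.unit &
    forall a b, divides p (a * b) -> divides p a \/ divides p b].

Definition prime_factorization a u s : Prop :=
  [/\ u \is a GRing.unit, forall p, p \in s -> prime_elt p &
    a = u * \prod_(p <- s) p].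

Definition factors a : Prop := exists u s, prime_factorization a u s.

Lemma divides_trans a b c : divides a b -> divides b c -> divides a c.
Proof. by move=> [x ->] [y ->]; exists (y * x); rewrite mulrA. Qed.

Lemma divides_mull a b c : divides a c -> divides a (b * c).
Proof. by move=> [x ->]; exists (b * x); rewrite mulrA. Qed.

Lemma divides_mulr a b c : divides a b -> divides a (b * c).
Proof. by rewrite mulrC; apply: divides_mull. Qed.

Lemma divides_add a b c : divides a b -> divides a c -> divides a (b + c).
Proof. by move=> [x ->] [y ->]; exists (x + y); rewrite mulrDl. Qed.

Lemma divides_sub a b c : divides a b -> divides a c -> divides a (b - c).
Proof. by move=> [x ->] [y ->]; exists (x - y); rewrite mulrBl. Qed.

Lemma divides_unit a u : u \is a GRing.unit -> divides a u ->
  a \is a GRing.unit.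
Proof. by move=> uU [x e]; move: uU; rewrite e unitrM => /andP[]. Qed.

Lemma prime_divides_prod p (I : Type) (r : seq I) (P : pred I) (E : I -> R) :
  prime_elt p -> divides p (\prod_(i <- r | P i) E i) ->
  exists2 i, P i & divides p (E i).
Proof.
move=> [p0 pU pP]; elim: r => [|i r IH].
  by rewrite big_nil => /(divides_unit (unitr1 R)); rewrite (negPf pU).
rewrite big_cons; case: ifP => // Pi /pP[]; last exact: IH.
by exists i.
Qed.

Lemma prime_divides_prod_seq p s : prime_elt p ->
  divides p (\prod_(q <- s) q) -> exists2 q, q \in s & divides p q.
Proof. by move=> pp; rewrite big_seq => /(prime_divides_prod pp). Qed.

Lemma prime_unit_mul u p : u \is a GRing.unit -> prime_elt p ->
  prime_elt (u * p).
Proof.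
have dv v a b : v \is a GRing.unit -> divides (v * a) b <-> divides a b.
  move=> vU; split=> -[x ->]; first by exists (x * v); rewrite mulrA.
  by exists (x / v); rewrite mulrA divrK.
move=> uU [p0 pU pP]; split.
- by rewrite mulf_neq0 //; apply: contraTneq uU => ->; rewrite unitr0.
- by rewrite unitrM uU.
- by move=> a b; rewrite !dv //; apply: pP.
Qed.

(** In [q = c * p] the prime [q] divides [c] or [p]; in the first case cancelling [q] would make [p]
    a unit. *)
Lemma prime_divides_prime p q : prime_elt p -> prime_elt q -> divides p q ->
  divides q p.
Proof.
move=> [p0 pU _] [q0 qU qP] [c e]; have := qP c p; rewrite -e.
case=> //; first by exists 1; rewrite mul1r.
move=> [d ec]; suff dp : d * p = 1.
  by case/negP: pU; apply/unitrPr; exists d; rewrite mulrC.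
by apply: (mulIf q0); rewrite mul1r [RHS]e ec mulrAC.
Qed.

Lemma factors_unit u : u \is a GRing.unit -> factors u.
Proof. by move=> uU; exists u, [::]; split=> //; rewrite big_nil mulr1. Qed.

Lemma factors_prime p : prime_elt p -> factors p.
Proof.
move=> pp; exists 1, [:: p]; split; rewrite ?unitr1 //.
  by move=> q; rewrite inE => /eqP ->.
by rewrite big_seq1 mul1r.
Qed.

Lemma factorsM a b : factors a -> factors b -> factors (a * b).
Proof.
move=> [u [s [uU sP ->]]] [v [t [vU tP ->]]]; exists (u * v), (s ++ t).
split; first by rewrite unitrM uU.
  by move=> p; rewrite mem_cat => /orP[/sP|/tP].
by rewrite big_cat /= mulrACA.
Qed.

End Factoriality.

(** Existence alone suffices to define unique factorization, because the factors are required to be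
    prime and not merely irreducible. *)
Definition factorial_ring (R : idomainType) : Prop :=
  forall a : R, a != 0 -> factors a.

(** A non-unit has at least one prime factor; irreducibility makes the cofactor a unit, so [a] is an
    associate of that prime. *)
Lemma factorial_irreducible_prime (R : idomainType) (a : R) :
  factorial_ring R -> a != 0 -> a \isn't a GRing.unit ->
  (forall b c, a = b * c -> b \is a GRing.unit \/ c \is a GRing.unit) ->
  prime_elt a.
Proof.
move=> RF a0 aU irr; have [u [[|p s] [uU sP e]]] := RF a a0.
  by move: aU; rewrite e big_nil mulr1 uU.
have pp : prime_elt p by apply: sP; rewrite mem_head.
rewrite big_cons mulrCA in e; have [pU|vU] := irr _ _ e.
  by case: pp; rewrite pU.
by rewrite e mulrC; apply: prime_unit_mul.
Qed.

(** Factorizations are pulled back along [g], whose multiplicativity follows from that of its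
    inverse [f]. *)
Lemma factorial_iso (R S : idomainType) (f : {rmorphism R -> S}) (g : S -> R) :
  cancel f g -> cancel g f -> factorial_ring S -> factorial_ring R.
Proof.
move=> fK gK SF a a0.
have gM : {morph g : x y / x * y}.
  by move=> x y; apply: (can_inj fK); rewrite rmorphM !gK.
have g1 : g 1 = 1 by apply: (can_inj fK); rewrite gK rmorph1.
have g0 : g 0 = 0 by apply: (can_inj fK); rewrite gK rmorph0.
have gU x : x \is a GRing.unit -> g x \is a GRing.unit.
  by move=> xU; apply/unitrPr; exists (g x^-1); rewrite -gM divrr.
have fd x y : divides x y -> divides (f x) (f y).
  by case=> c ->; exists (f c); rewrite rmorphM.
have gd x y : divides x y -> divides (g x) (g y).
  by case=> c ->; exists (g c); rewrite gM.
have [|u [s [uU sP e]]] := SF (f a).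
  by apply: contra_neq a0 => fa0; rewrite -(fK a) fa0 g0.
exists (g u), (map g s); split; first exact: gU.
  move=> _ /mapP[p /sP[p0 pU pP] ->]; split.
  - by apply: contra_neq p0 => gp0; rewrite -(gK p) gp0 rmorph0.
  - by apply: contra pU => /(rmorph_unit f); rewrite gK.
  - move=> x y /fd; rewrite gK rmorphM.
    by case/pP=> /gd; rewrite !fK; [left|right].
by rewrite big_map -(fK a) e gM (big_morph g gM g1).
Qed.

(* Gauss's lemma: divisibility in [{poly R}] over the fraction field is
   pseudo-divisibility [%|], and denominators are cancelled prime by prime. *)
Section Gauss.
Variable R : idomainType.
Implicit Types (a p : R) (f g h : {poly R}).

Lemma coef_divides_polyC p f i : divides p%:P f -> divides p f`_i.
Proof. by case=> g ->; exists g`_i; rewrite coefMC. Qed.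

Lemma prime_polyC p : prime_elt p -> prime_elt p%:P.
Proof.
move=> [p0 pU pP]; split; first by rewrite polyC_eq0.
  by rewrite poly_unitE coefC eqxx (negPf pU) andbF.
move=> f g; have [n] := ubnP (size f + size g).
elim: n f g => // n IH f g ltn pfg.
have [->|f0] := eqVneq f 0; first by left; exists 0; rewrite mul0r.
have [->|g0] := eqVneq g 0; first by right; exists 0; rewrite mul0r.
pose tail h := h - lead_coef h *: 'X^((size h).-1).
have tailP h : h != 0 -> (size (tail h) < size h)%N.
  move=> h0; have sh : (0 < size h)%N by rewrite size_poly_gt0.
  rewrite -(prednK sh) ltnS; apply/leq_sizeP => j.
  rewrite leq_eqVlt => /orP[/eqP <-|lj]; rewrite coefB coefZ coefXn.
    by rewrite eqxx mulr1 subrr.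
  by rewrite gtn_eqF // mulr0 subr0 nth_default // -(prednK sh).
have leadP h : divides p (lead_coef h) ->
    divides p%:P (lead_coef h *: 'X^((size h).-1)).
  case=> c ->; exists (c%:P * 'X^((size h).-1)).
  by rewrite -mul_polyC polyCM mulrAC.
have tailK h : tail h + lead_coef h *: 'X^((size h).-1) = h by rewrite subrK.
have : divides p (lead_coef f * lead_coef g).
  by rewrite -lead_coefM; apply: coef_divides_polyC.
case/pP=> /leadP dl.
  have [||dt|] := IH (tail f) g; last by right.
  - by rewrite -ltnS; apply: leq_trans ltn; rewrite ltnS ltn_add2r tailP.
  - by rewrite mulrBl; apply: divides_sub => //; apply: divides_mulr.
  by left; rewrite -(tailK f); apply: divides_add.
have [||dt|dt] := IH f (tail g); [| |by left|].
- by rewrite -ltnS; apply: leq_trans ltn; rewrite ltnS ltn_add2l tailP.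
- by rewrite mulrBr; apply: divides_sub => //; apply: divides_mull.
by right; rewrite -(tailK g); apply: divides_add.
Qed.

(** For nonzero [f] over a factorial ring this says that the content is a unit, without mentioning
    gcds of coefficients. *)
Definition primitive f : Prop :=
  forall p, prime_elt p -> ~ divides p%:P f.

Lemma factors_polyC a : factors a -> factors a%:P.
Proof.
move=> [u [s [uU sP ->]]]; exists u%:P, (map polyC s); split.
- exact: rmorph_unit.
- by move=> _ /mapP[p /sP pp ->]; apply: prime_polyC.
- by rewrite polyCM big_map rmorph_prod.
Qed.

Hypothesis RF : factorial_ring R.

(** Primes are divided out of [f] one at a time; each is a factor of the leading coefficient, whose
    number of prime factors bounds the process. *)
Lemma primitive_part f : f != 0 ->
  exists a g, [/\ a != 0, f = a%:P * g & primitive g].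
Proof.
move=> f0; have [|u [s [uU sP]]] := RF (a := lead_coef f).
  by rewrite lead_coef_eq0.
have [n] := ubnP (size s); elim: n s sP f f0 => // n IH s sP f f0 ltn lf.
have [[p ps [g e]]|noP] := EM (exists2 p, p \in s & divides p%:P f).
  have [p0 pU _] := sP p ps.
  have g0 : g != 0 by apply: contra_neq f0 => g0; rewrite e g0 mul0r.
  have ss : (size (rem p s) < n)%N.
    by rewrite size_rem //; move: ltn; case: (s) ps.
  have lg : lead_coef g = u * \prod_(q <- rem p s) q.
    apply: (mulIf p0); rewrite -[in LHS](lead_coefC p) -lead_coefM -e lf.
    by rewrite (big_rem p) //= mulrCA mulrC.
  have [q qs|a [h [a0 eg hP]]] := IH _ _ g g0 ss lg; first exact/sP/mem_rem/qs.
  exists (a * p), h; split=> //; first by rewrite mulf_neq0.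
  by rewrite e eg polyCM mulrAC.
(* No prime of the list divides [f]. A prime [p] dividing [f] would divide the leading coefficient,
   hence a member [q] of the list; [q] then divides [p] and so [f], a contradiction. *)
exists 1, f; split; rewrite ?oner_eq0 ?mul1r // => p pp pf.
have := coef_divides_polyC (size f).-1 pf; rewrite -lead_coefE lf => -[c].
have [_ pU pP] := pp.
move=> /esym ec; have [|pu|ps] := pP u (\prod_(q <- s) q).
- by exists c.
- by rewrite (divides_unit uU pu) in pU.
have [q qs pq] := prime_divides_prod_seq pp ps; case: noP; exists q => //.
have [d dp] := prime_divides_prime pp (sP q qs) pq.
by apply: divides_trans pf; exists d%:P; rewrite dp polyCM.
Qed.

(** Each prime factor of [a] divides [h * f] but not the primitive [f], so it can be cancelled
    against [h]. *)
Lemma primitive_cancel a f g h : a != 0 -> primitive f ->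
  a%:P * g = h * f -> divides f g.
Proof.
move=> a0 fP; have [u [s [uU sP ->]]] := RF a0.
elim: s sP h => [|p s IH] sP h.
  rewrite big_nil mulr1 => e; exists (u^-1%:P * h).
  by rewrite -mulrA -e mulrA -polyCM mulVr // mul1r.
have pp : prime_elt p by apply: sP; rewrite mem_head.
rewrite big_cons mulrCA polyCM -mulrA => e.
have [_ _ pP] := prime_polyC pp; have [||pf] := pP h f; last by case: (fP p).
  by exists ((u * \prod_(q <- s) q)%:P * g); rewrite -e mulrC.
case=> h' eh; apply: (IH _ h').
  by move=> q qs; apply: sP; rewrite in_cons qs orbT.
have [p0 _ _] := prime_polyC pp; apply: (mulfI p0).
by rewrite e eh -mulrA mulrCA.
Qed.

(** Each prime factor of [a] stays prime as a constant polynomial, so it divides [g] or [h] and is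
    cancelled there; this does not change sizes. *)
Lemma clear_denominators a f g h : a != 0 -> a%:P * f = g * h ->
  exists g' h', [/\ f = g' * h', (size g' <= size g)%N & (size h' <= size h)%N].
Proof.
move=> a0; have [u [s [uU sP ->]]] := RF a0.
elim: s sP g h => [|p s IH] sP g h.
  rewrite big_nil mulr1 => e; exists (u^-1%:P * g), h; split=> //.
    by rewrite -mulrA -e mulrA -polyCM mulVr // mul1r.
  by rewrite mul_polyC; apply: size_scale_leq.
have pp : prime_elt p by apply: sP; rewrite mem_head.
have [p0 _ pP] := prime_polyC pp; have [q0 _ _] := pp.
have sP' q : q \in s -> prime_elt q.
  by move=> qs; apply: sP; rewrite in_cons qs orbT.
have szp g' : size (g' * p%:P) = size g'.
  by rewrite mulrC mul_polyC size_scale.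
rewrite big_cons mulrCA polyCM -mulrA => e.
have [|[g' eg]|[h' eh]] := pP g h.
- by exists ((u * \prod_(q <- s) q)%:P * f); rewrite -e mulrC.
- have := IH sP' g' h; rewrite eg szp; apply.
  by apply: (mulfI p0); rewrite e eg -mulrA mulrCA.
- have := IH sP' g h'; rewrite eh szp; apply.
  by apply: (mulfI p0); rewrite e eh mulrA mulrC.
Qed.

(** [irreducible_poly] means irreducible over the fraction field. Primality holds there, and
    [primitive_cancel] turns pseudo-divisibility by [f] into divisibility. *)
Lemma primitive_irreducible_prime f : primitive f -> irreducible_poly f ->
  prime_elt f.
Proof.
move=> fP irr; have f0 := irredp_neq0 irr; have [sf _] := irr; split=> //.
  by rewrite poly_unitE gtn_eqF.
have dvdE g : f %| g -> divides f g.
  case/Pdiv.Idomain.dvdpP=> [[a h] /= a0]; rewrite -mul_polyC.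
  exact: primitive_cancel.
move=> g h [c e]; have dgh : f %| g * h by rewrite e dvdp_mulIr.
have [/dvdE|ndfg] := boolP (f %| g); first by left.
(* An irreducible [f] not dividing [g] is coprime to [g], so it divides [h]. *)
right; apply: dvdE; rewrite -(Gauss_dvdpr h (d := f) (q := g)) //.
have := dvdp_gcdl f g; rewrite /coprimep; apply: contraLR => /irr irr'.
apply: contra ndfg => /irr' /eqp_dvdl <-; exact: dvdp_gcdr.
Qed.

(** Induction on the size. The content factors in [R]; a primitive part that is neither constant nor
    irreducible splits over the fraction field, and clearing denominators gives a splitting over [R]
    into smaller factors. *)
Theorem factorial_poly : factorial_ring {poly R}.
Proof.
move=> f; have [n] := ubnP (size f); elim: n f => // n IH f ltn f0.
have [a [g [a0 e gP]]] := primitive_part f0.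
have sfg : size f = size g by rewrite e mul_polyC size_scale.
rewrite e; apply: factorsM; first exact/factors_polyC/RF.
have g0 : g != 0 by rewrite -size_poly_gt0 -sfg size_poly_gt0.
have [sg|sg] := leqP (size g) 1.
  rewrite (size1_polyC sg); apply/factors_polyC/RF.
  by rewrite -polyC_eq0 -size1_polyC.
have [irr|red] := EM (irreducible_poly g).
  exact/factors_prime/primitive_irreducible_prime.
have [h [sh hg ngh]] : exists h, [/\ size h != 1, h %| g & ~~ (h %= g)].
  apply: contrapT => nex; apply: red; split=> // h sh hg.
  by apply/negPn/negP => ngh; apply: nex; exists h.
have [[c r] /= c0 er] := Pdiv.Idomain.dvdpP _ _ hg.
have h0 := dvdpN0 hg g0.
have r0 : r != 0.
  apply: contraTneq g0 => r0; move/eqP: er.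
  by rewrite r0 mul0r -mul_polyC mulf_eq0 polyC_eq0 (negPf c0) /= => ->.
rewrite -mul_polyC in er.
(* [h] is neither constant nor associated to [g], so [h] and its cofactor [r] are both smaller than
   [g]. *)
have ltsh : (size h < size g)%N.
  rewrite ltn_neqAle (dvdp_leq g0 hg) andbT.
  by apply: contraNneq ngh => /eqP; rewrite (dvdp_size_eqp hg).
have h1 : (1 < size h)%N.
  by move: h0 sh; rewrite -size_poly_gt0; case: (size h) => [|[]].
have ltsr : (size r < size g)%N.
  have : size (c%:P * g) = size (r * h) by rewrite er.
  rewrite mul_polyC size_scale // size_mul // => ->.
  case: (size h) h1 => [|[|m]] // _.
  by rewrite addnS /= addnS ltnS leq_addr.
have [r' [h' [eg sr' sh']]] := clear_denominators c0 er.
rewrite eg; move: g0; rewrite eg mulf_eq0 negb_or => /andP[r'0 h'0].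
apply: factorsM; apply: IH => //.
  by apply: leq_ltn_trans sr' _; apply: leq_trans ltsr _; rewrite -sfg -ltnS.
by apply: leq_ltn_trans sh' _; apply: leq_trans ltsh _; rewrite -sfg -ltnS.
Qed.

End Gauss.

(** * Polynomials over a field form a factorial domain *)

Section MUniIso.
Variables (n : nat) (R : comNzRingType).
Local Notation widen := (widen_ord (leqnSn n)).

Definition muni_inv (P : {poly {mpoly R[n]}}) : {mpoly R[n.+1]} :=
  (mpwiden P).['X_ord_max].

Lemma muniX (m : 'X_{1..n.+1}) :
  muni 'X_[R, m] =
  'X_[[multinom (m (widen i)) | i < n]] *: 'X^(m ord_max).
Proof. by rewrite muniE msuppX big_seq1 mcoeffX eqxx scale1r. Qed.

Lemma muni_mwiden (p : {mpoly R[n]}) : muni (mwiden p) = p%:P.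
Proof.
rewrite [in LHS](mpolyE p) [in RHS](mpolyE p).
rewrite (raddf_sum (@mwiden n R)) !raddf_sum /=.
apply: eq_bigr => m _; rewrite mwidenZ muniZ mwidenX muniX.
rewrite -mul_mpolyC polyCM mul_polyC; congr (_ *: _).
rewrite mnmwiden_ordmax expr0 alg_polyC; congr ('X_[_])%:P.
by apply/mnmP => i; rewrite mnmE mnmwiden_widen.
Qed.

(** Horner induction: both maps respect the passage from [P] to [P * 'X + c%:P]. *)
Lemma muni_invK : cancel muni_inv (@muni n R).
Proof.
elim/poly_ind => [|P c IH]; first by rewrite /muni_inv raddf0 horner0 raddf0.
rewrite /muni_inv raddfD /= rmorphM /= mpwidenX mpwidenC.
rewrite hornerD hornerMX hornerC.
rewrite muniD muniM muni_mwiden -/(muni_inv P) IH muniX mnm1E eqxx.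
rewrite (_ : [multinom _ | _ < n] = 0%MM) ?mpolyX0 ?scale1r ?expr1 //.
apply/mnmP => j; rewrite mnmE mnm1E mnm0E; case: eqP => // /(congr1 val) /=.
by move=> e; have := ltn_ord j; rewrite -e ltnn.
Qed.

Lemma muniK : cancel (@muni n R) muni_inv.
Proof.
move=> p; rewrite muniE /muni_inv raddf_sum /= horner_sum [RHS]mpolyE.
apply: eq_bigr => m _; rewrite mpwidenZ mwidenZ mwidenX.
rewrite rmorphXn /= mpwidenX hornerZ hornerXn -scalerAl mpolyXn -mpolyXD.
congr (_ *: 'X_[_]); apply/mnmP => i; rewrite mnmDE mulmnE mnm1E.
(* Exponents are compared variable by variable: an index other than the last is the widening of some
   [j]. *)
have [j ->|->] := unliftP ord_max i.
  rewrite (negPf (neq_lift _ _)) mul0n addn0.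
  rewrite (_ : lift _ _ = widen j) ?mnmwiden_widen ?mnmE //.
  by apply: val_inj; rewrite /= /bump leqNgt ltn_ord.
by rewrite eqxx mul1n mnmwiden_ordmax.
Qed.

End MUniIso.

(** Without variables, nonzero polynomials are nonzero constants, hence units; [muni] splits off the
    last variable in the inductive step. *)
Lemma mpoly_factorial (F : fieldType) (k : nat) : factorial_ring {mpoly F[k]}.
Proof.
elim: k => [|k IH].
  move=> p p0; apply: factors_unit.
  have pE : p = p@_0%MM *: 1.
    rewrite [LHS]mpolyE; apply/mpolyP => m.
    rewrite (_ : m = 0%MM) -?mpolyE ?mcoeffZ ?mcoeff1 ?eqxx ?mulr1 //.
    by apply/mnmP => -[].
  have c0 : p@_0%MM != 0 by apply: contra_neq p0 => c0; rewrite pE c0 scale0r.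
  by apply/unitrPr; exists ((p@_0%MM)^-1 *: 1);
    rewrite {1}pE -scalerAl mul1r scalerA divff // scale1r.
apply: factorial_iso (@muniK k F) (@muni_invK k F) _.
exact: factorial_poly.
Qed.

(** * Additivity of the multidegree *)

Section Degree.
Variables (k : nat) (F : finFieldType) (i : 'I_k).
Implicit Types p q : {mpoly F[k]}.

(* Substituting x_i * t for x_i makes the t-degree record the degree in x_i. *)
Definition tag_var p : {poly {mpoly F[k]}} :=
  mmap (polyC \o @mpolyC _ _)
    (fun j => ('X_j)%:P * (if j == i then 'X else 1)) p.

Lemma tag_varX (m : 'X_{1..k}) :
  mmap1 (fun j => ('X_j)%:P * (if j == i then 'X else 1)) m =
  ('X_[m] : {mpoly F[k]}) *: 'X^(m i).
Proof.
rewrite /mmap1; under eq_bigr do rewrite exprMn.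
rewrite big_split /= [X in _ * X](bigD1 i) //= eqxx.
rewrite [X in _ * (_ * X)]big1 ?mulr1; last first.
  by move=> j /negPf ->; rewrite expr1n.
rewrite -mul_polyC mpolyXE_id rmorph_prod; congr (_ * _).
by apply: eq_bigr => j _; rewrite rmorphXn.
Qed.

Lemma tag_varE p :
  tag_var p = \sum_(m <- msupp p) (p@_m *: 'X_[m]) *: 'X^(m i).
Proof.
apply: eq_bigr => m _; rewrite tag_varX /= -!mul_polyC.
by rewrite -mul_mpolyC polyCM mulrA.
Qed.

Lemma tag_varM : {morph tag_var : p q / p * q}.
Proof.
move=> p q; apply: (@mmap_is_multiplicative _ _ _ _ _).1.
Qed.

(** Tagging keeps the monomial of each term, so distinct terms of [p] cannot cancel. *)
Lemma coef_tag_var p e t : (tag_var p)`_e@_t = if t i == e then p@_t else 0.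
Proof.
rewrite tag_varE coef_sum raddf_sum /=.
have zero s : s != t ->
    ((p@_s *: 'X_[s] *: 'X^(s i) : {poly {mpoly F[k]}})`_e)@_t = 0.
  move=> st; rewrite coefZ coefXn.
  case: eqP => _; last by rewrite mulr0 mcoeff0.
  by rewrite mulr1 mcoeffZ mcoeffX (negPf st) mulr0.
have [tp|tp] := boolP (t \in msupp p); last first.
  rewrite big_seq big1; first by rewrite memN_msupp_eq0 // if_same.
  by move=> s sp; apply: zero; apply: contraNneq tp => <-.
rewrite (big_rem t) //= big_seq big1 ?addr0.
  rewrite coefZ coefXn eq_sym; case: eqP => _; last by rewrite mulr0 mcoeff0.
  by rewrite mulr1 mcoeffZ mcoeffX eqxx mulr1.
move=> s; rewrite mem_rem_uniq // inE => /andP[st _]; exact: zero.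
Qed.

Lemma size_tag_var p : p != 0 -> size (tag_var p) = (multideg p i).+1.
Proof.
move=> p0; rewrite mnmE; apply/anti_leq/andP; split.
  apply/leq_sizeP => e le; apply/mpolyP => t; rewrite coef_tag_var mcoeff0.
  case: eqP => // te; rewrite memN_msupp_eq0 //; apply/negP => tp.
  suff : (t i <= \max_(t <- msupp p) t i)%N by rewrite te leqNgt le.
  exact: leq_bigmax_seq.
have : (0 < size (msupp p))%N by rewrite lt0n size_eq0 msupp_eq0.
case E : (msupp p) => [//|s0 ss] _.
have [t tp te] : exists2 t : 'X_{1..k}, t \in msupp p &
    (\max_(t <- msupp p) t i)%N = t i.
  rewrite E; elim: (ss) (s0) => {s0 ss E} [|s1 s IH] s0.
    by exists s0; rewrite ?mem_head ?big_seq1.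
  have [t ts te] := IH s1; rewrite big_cons te /maxn; case: ltnP => _.
    by exists t; rewrite // in_cons ts orbT.
  by exists s0; rewrite ?mem_head.
(* Here [t] attains the maximal exponent. If the size were at most [t i], the coefficient at [t i]
   would vanish, and with it the coefficient of [p] at [t]. *)
rewrite -E te; apply: contraTltn (tp) => /leq_sizeP /(_ _ (leqnn _)) e.
have := coef_tag_var p (t i) t; rewrite e mcoeff0 eqxx mcoeff_msupp => <-.
by rewrite eqxx.
Qed.

End Degree.

Lemma multidegM (k : nat) (F : finFieldType) (p q : {mpoly F[k]}) :
  p != 0 -> q != 0 -> multideg (p * q) = (multideg p + multideg q)%MM.
Proof.
move=> p0 q0; apply/mnmP => i; rewrite mnmDE.
have pq0 : p * q != 0 by rewrite mulf_neq0.
have := size_tag_var i pq0; rewrite tag_varM.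
(* [tag_var] must be abstracted: unification would unfold it. *)
move: (size_tag_var i p0) (size_tag_var i q0).
move: (tag_var i p) (tag_var i q) => P Q sP sQ.
by rewrite size_mul -?size_poly_gt0 ?sP ?sQ // addnS => -[].
Qed.

(** * Squarefree normalized polynomials *)

Section Squarefree.
Variables (F : finFieldType) (k : nat).
Implicit Types (p q r : {mpoly F[k]}) (f g h : normpoly F k).
Implicit Types (s : seq (normpoly F k)).

Lemma unit_mpolyC p : p \is a GRing.unit -> exists2 c : F, c != 0 & p = c%:MP.
Proof.
case/andP=> /eqP pE cU; exists p@_0%MM => //.
by apply: contraTneq cU => ->; rewrite unitr0.
Qed.

Lemma mpolyC_unit (c : F) : c != 0 -> (c%:MP : {mpoly F[k]}) \is a GRing.unit.
Proof. by move=> c0; rewrite -[c%:MP]mulr1 mul_mpolyC unitZ // unitr1. Qed.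

Lemma mdvd_refl p : mdvd p p.
Proof. by exists 1; rewrite mul1r. Qed.

(** The chosen representative of the class of [p] is a nonzero scalar multiple of [p], so the two
    are interchangeable here and in the next lemmas. *)
Lemma mdvd_repr_pi p q : mdvd (repr (\pi_(normpoly F k) p)) q <-> mdvd p q.
Proof. by have [c c0 ->] := repr_pi p; apply: mdvdZl. Qed.

Lemma mdvd_pi_repr p q : mdvd q (repr (\pi_(normpoly F k) p)) <-> mdvd q p.
Proof. by have [c c0 ->] := repr_pi p; apply: mdvdZr. Qed.

Lemma repr_pi_eq0 p : (repr (\pi_(normpoly F k) p) == 0) = (p == 0).
Proof. by have [c c0 ->] := repr_pi p; rewrite scaler_eq0 (negPf c0). Qed.

Lemma multideg_repr_pi p : multideg (repr (\pi_(normpoly F k) p)) = multideg p.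
Proof. by have [c c0 ->] := repr_pi p; rewrite multidegZ. Qed.

Lemma pi_eq p q (c : F) : c != 0 -> p = c *: q ->
  \pi_(normpoly F k) p = \pi_(normpoly F k) q.
Proof. by move=> c0 e; apply/eqmodP/assocP; exists c. Qed.

(** The two cofactors multiply to 1, so they are nonzero constants. *)
Lemma mdvd_anti p q : p != 0 -> mdvd p q -> mdvd q p ->
  \pi_(normpoly F k) p = \pi_(normpoly F k) q.
Proof.
move=> p0 [a ea] [b eb].
have ba : b * a = 1 by apply: (mulIf p0); rewrite mul1r -mulrA -ea -eb.
have [|c c0 bE] := @unit_mpolyC b; first by apply/unitrPr; exists a.
by apply: (pi_eq c0); rewrite {1}eb bE mul_mpolyC.
Qed.

Lemma repr_anti f g : repr f != 0 -> mdvd (repr f) (repr g) ->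
  mdvd (repr g) (repr f) -> f = g.
Proof. by move=> f0 fg gf; rewrite -[f]reprK -[g]reprK; apply: mdvd_anti. Qed.

Lemma pi_repr_mul p q :
  \pi_(normpoly F k) (repr (\pi_(normpoly F k) p) * q) =
  \pi_(normpoly F k) (p * q).
Proof.
by have [c c0 ->] := repr_pi p; apply: (pi_eq c0); rewrite -scalerAl.
Qed.

Lemma mirreducible_prime p : mirreducible p -> prime_elt p.
Proof.
case=> p0 pU irr; apply: factorial_irreducible_prime => //.
exact: mpoly_factorial.
Qed.

Lemma prime_mirreducible p : prime_elt p -> mirreducible p.
Proof.
case=> p0 pU pP; split=> // q r e.
have [q0 r0] : q != 0 /\ r != 0.
  by apply/andP; rewrite -negb_or -mulf_eq0 -e.
have [|[c ec]|[c ec]] := pP q r; first by rewrite -e; exact: mdvd_refl.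
  right; apply/unitrPr; exists c; apply: (mulIf q0).
  by rewrite mul1r [RHS]ec e -mulrA mulrC -mulrA.
left; apply/unitrPr; exists c; apply: (mulIf r0).
by rewrite mul1r [RHS]ec e (mulrC q) -mulrA.
Qed.

Lemma mirreducible_repr_pi p : mirreducible p ->
  mirreducible (repr (\pi_(normpoly F k) p)).
Proof. by have [c c0 ->] := repr_pi p => /(mirreducibleZ _ c0). Qed.

Lemma mirreducible_dvd_eq f g :
  mirreducible (repr f) -> mirreducible (repr g) ->
  mdvd (repr f) (repr g) -> f = g.
Proof.
move=> fi gi fg; apply: repr_anti => //; first by case: fi.
by apply: prime_divides_prime fg; apply: mirreducible_prime.
Qed.

Definition all_irr s := forall f, f \in s -> mirreducible (repr f).

Definition prodN s : normpoly F k := \pi_(normpoly F k) (\prod_(f <- s) repr f).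

Lemma prod_irr_neq0 s : all_irr s -> \prod_(f <- s) repr f != 0.
Proof. by move=> si; rewrite prodf_seq_neq0; apply/allP => f /si[]. Qed.

Lemma prodN_neq0 s : all_irr s -> repr (prodN s) != 0.
Proof. by move=> si; rewrite repr_pi_eq0 prod_irr_neq0. Qed.

(** Being prime, [repr g] divides some factor, and divisibility between irreducibles is equality of
    classes. The product thus determines its set of factors. *)
Lemma irr_dvd_prod s g : all_irr s -> mirreducible (repr g) ->
  mdvd (repr g) (\prod_(f <- s) repr f) <-> g \in s.
Proof.
move=> si gi; split=> [|gs]; last first.
  by rewrite (big_rem g) //= mulrC; apply: divides_mull; apply: mdvd_refl.
rewrite big_seq => /(prime_divides_prod (mirreducible_prime gi)) [f fs].
by move/(mirreducible_dvd_eq gi (si f fs)) => ->.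
Qed.

Lemma irr_dvd_prodN s g : all_irr s -> mirreducible (repr g) ->
  mdvd (repr g) (repr (prodN s)) <-> g \in s.
Proof. by move=> si gi; rewrite mdvd_pi_repr; apply: irr_dvd_prod. Qed.

Lemma prodN_inj s t : all_irr s -> all_irr t -> prodN s = prodN t -> s =i t.
Proof.
move=> si ti e f; apply/idP/idP => fs.
  by have fi := si f fs; rewrite -irr_dvd_prodN // -e irr_dvd_prodN.
by have fi := ti f fs; rewrite -irr_dvd_prodN // e irr_dvd_prodN.
Qed.

Lemma prodN_perm s t : perm_eq s t -> prodN s = prodN t.
Proof. by move=> st; rewrite /prodN (perm_big _ st). Qed.

(** At [repr h] this is the condition tested by [mobius]. *)
Definition square_divisible q := exists2 p, mirreducible p & mdvd (p ^+ 2) q.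

Lemma prodN_squarefree s : uniq s -> all_irr s ->
  ~ square_divisible (repr (prodN s)).
Proof.
move=> us si [p pi]; rewrite mdvd_pi_repr => p2.
set g := \pi_(normpoly F k) p; have gi := mirreducible_repr_pi pi.
have p0 : p != 0 by case: pi.
have gs : g \in s.
  rewrite -irr_dvd_prod // mdvd_repr_pi; apply: divides_trans p2.
  by exists p; rewrite expr2.
(* Cancelling one [p] from [p ^+ 2] would leave [p] dividing the product of the other members, none
   of which is its class [g]. *)
have : ~ mdvd p (\prod_(f <- rem g s) repr f).
  rewrite -mdvd_repr_pi irr_dvd_prod //; first by rewrite mem_rem_uniqF.
  by move=> f /mem_rem /si.
case: p2 => c; rewrite (big_rem g) //=; have [a a0 ->] := repr_pi p.
move=> e; apply; apply/(mdvdZr _ _ a0); exists c.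
by apply: (mulIf p0); rewrite -scalerAl mulrC scalerAl e expr2 mulrA.
Qed.

Lemma prod_distinct_irr_prodN s : uniq s -> all_irr s ->
  prod_distinct_irr (prodN s) (size s).
Proof.
move=> us si; exists [fset x in s]%fset.
have ps : perm_eq [fset x in s]%fset s.
  by apply: uniq_perm => // x; rewrite inE.
split; last exact/esym/prodN_perm.
  by move=> f; rewrite inE; apply: si.
exact: perm_size ps.
Qed.

(** The exponent chosen by [xget] is forced: any other set of irreducibles with the same product has
    the same elements. *)
Lemma mobius_prodN s : uniq s -> all_irr s -> mobius (prodN s) = (-1) ^+ size s.
Proof.
move=> us si; rewrite /mobius asboolF; last exact: prodN_squarefree.
congr (_ ^+ _); apply: xget_unique; first exact: prod_distinct_irr_prodN.
move=> _ [S [Si <- e]]; apply: perm_size; apply: uniq_perm => //.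
by apply: prodN_inj => //; rewrite e.
Qed.

Lemma mobius_square h : square_divisible (repr h) -> mobius h = 0.
Proof. by move=> sq; rewrite /mobius asboolT. Qed.

Lemma mpoly_factorization p : p != 0 ->
  exists u (s : seq {mpoly F[k]}), [/\ u \is a GRing.unit,
    forall q, q \in s -> prime_elt q & p = u * \prod_(q <- s) q].
Proof. exact: mpoly_factorial. Qed.

(** Induction along a prime factorization of [repr h], whose unit is absorbed by normalization. *)
Lemma squarefree_prodN h : repr h != 0 -> ~ square_divisible (repr h) ->
  exists s, [/\ uniq s, all_irr s & h = prodN s].
Proof.
move=> h0; have [u [s [uU sP e]]] := mpoly_factorization h0.
have -> : h = \pi_(normpoly F k) (u * \prod_(p <- s) p) by rewrite -e reprK.
elim: s sP {e h0} => [|p s IH] sP nsq.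
  exists [::]; split=> //; rewrite /prodN !big_nil mulr1.
  have [c c0 ->] := unit_mpolyC uU; apply: (pi_eq c0).
  by rewrite -mul_mpolyC mulr1.
have pp : prime_elt p by apply: sP; rewrite mem_head.
have [p0 _ _] := pp.
have [||t [ut ti et]] := IH.
- by move=> q qs; apply: sP; rewrite in_cons qs orbT.
- case=> q qi; rewrite mdvd_pi_repr => q2; apply: nsq; exists q => //.
  by rewrite mdvd_pi_repr big_cons mulrCA; apply: divides_mull.
have pi := prime_mirreducible pp; have gi := mirreducible_repr_pi pi.
exists (\pi_(normpoly F k) p :: t); split.
(* If the class of [p] already occurred in [t], then [p ^+ 2] would divide the whole product. *)
- rewrite /= ut andbT; apply/negP => /(irr_dvd_prodN ti gi).
  rewrite -et mdvd_repr_pi mdvd_pi_repr => -[c ec]; apply: nsq; exists p => //.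
  by rewrite mdvd_pi_repr big_cons mulrCA ec; exists c; rewrite expr2 mulrCA.
- by move=> f; rewrite inE => /orP[/eqP ->|/ti].
- rewrite /prodN !big_cons pi_repr_mul mulrCA [in LHS]mulrC.
  by rewrite -[in LHS]pi_repr_mul et pi_repr_mul mulrC.
Qed.

End Squarefree.

(** * Signed counts of finite sets *)

(** Expand the product of the factors [-1 + 1] over [X]. *)
Lemma sum_sign_sets (X : finType) :
  \sum_(T : {set X}) (-1) ^+ #|T| = (#|X| == 0%N)%:R :> int.
Proof.
transitivity (\prod_(x : X) ((-1 : int) + 1)); last first.
  by rewrite prodr_const addNr expr0n.
rewrite bigA_distr; apply: eq_bigr => T _.
by rewrite -big_mkcond prodr_const.
Qed.

(** A set amounts to its color classes, and the class of color [j] is an arbitrary subset of size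
    [a j] of the fibre of [c] over [j]. *)
Lemma card_sets_by_color (X J : finType) (c : X -> J) (a : J -> nat) :
  #|[set T : {set X} | [forall j, #|[set x in T | c x == j]| == a j]]| =
  (\prod_j 'C(#|[set x | c x == j]|, a j))%N.
Proof.
pose phi (T : {set X}) : {ffun J -> {set X}} :=
  [ffun j => [set x in T | c x == j]].
have phi_inj : injective phi.
  move=> T T' e; apply/setP => x; move/ffunP/(_ (c x))/setP/(_ x): e.
  by rewrite !ffunE !inE eqxx !andbT.
pose E j : {pred {set X}} :=
  [set A : {set X} | A \subset [set x | c x == j] & #|A| == a j].
transitivity #|(family E : simpl_pred {ffun J -> {set X}})|.
  rewrite -(card_imset _ phi_inj); apply: eq_card => A.
  apply/imsetP/familyP => [[T] | AE].
    rewrite inE => /forallP aT -> j; rewrite ffunE inE aT andbT.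
    by apply/fintype.subsetP => x; rewrite !inE => /andP[].
  have AP j x : x \in A j -> c x = j.
    have := AE j; rewrite inE => /andP[/fintype.subsetP sA _] /sA.
    by rewrite inE => /eqP.
  (* The pieces are glued by keeping [x] when it lies in the piece of its own color. *)
  have phiA : A = phi [set x | x \in A (c x)].
    apply/ffunP => j; rewrite ffunE; apply/setP => x; rewrite !inE.
    apply/idP/andP => [xA|[xA /eqP <-] //]; have cx := AP _ _ xA.
    by rewrite cx eqxx.
  exists [set x | x \in A (c x)] => //.
  rewrite inE; apply/forallP => j; have := AE j; rewrite inE => /andP[_].
  by rewrite {1}phiA ffunE.
rewrite card_family foldrE big_map big_enum; apply: eq_bigr => j _.
by rewrite -cards_draws; apply: eq_card => A; rewrite inE.
Qed.

(** * Möbius sums as signed counts of sets of irreducibles *)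

Section MobiusSum.
Variables (F : finFieldType) (k : nat) (U : {fset normpoly F k}).
Hypothesis U_irr : all_irr U.
Implicit Types (T : {set U}) (f g h : normpoly F k).

Definition elems T : seq (normpoly F k) := [seq val x | x <- enum T].

Lemma elems_uniq T : uniq (elems T).
Proof. by rewrite map_inj_uniq ?enum_uniq //; apply: val_inj. Qed.

Lemma elems_irr T : all_irr (elems T).
Proof. by move=> f /mapP[x _ ->]; apply: U_irr; apply: valP. Qed.

Lemma mem_elems T (x : U) : (val x \in elems T) = (x \in T).
Proof. by rewrite mem_map ?mem_enum //; apply: val_inj. Qed.

Lemma size_elems T : size (elems T) = #|T|.
Proof. by rewrite size_map cardE. Qed.

Lemma prodN_elems_inj : injective (fun T => prodN (elems T)).
Proof.
move=> T T' /prodN_inj e; apply/setP => x; rewrite -!mem_elems.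
by rewrite e //; apply: elems_irr.
Qed.

(** Members of [H] divisible by a square contribute 0. Each other member is the product of a unique
    subset of [U], since all its irreducible divisors lie in [U]. *)
Lemma sum_mobius (H : {fset normpoly F k}) :
  (forall h, h \in H -> repr h != 0) ->
  (forall h f, h \in H -> mirreducible (repr f) -> mdvd (repr f) (repr h) ->
    f \in U) ->
  \sum_(h <- H) mobius h =
  \sum_(T : {set U} | prodN (elems T) \in H) (-1) ^+ #|T|.
Proof.
move=> H0 HU; pose sqd h := `[< square_divisible (repr h) >].
rewrite (bigID sqd) /= big1 ?add0r; last by move=> h /asboolP /mobius_square.
rewrite -big_filter.
have -> : \sum_(T : {set U} | prodN (elems T) \in H) (-1 : int) ^+ #|T| =
    \sum_(h <- [seq prodN (elems T) |
      T <- enum [set T | prodN (elems T) \in H]]) mobius h.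
  rewrite big_map big_enum_cond /=; apply: eq_big => [T|T _].
    by rewrite inE andbT.
  rewrite mobius_prodN ?size_elems //; first exact: elems_uniq.
  exact: elems_irr.
apply: perm_big; apply: uniq_perm; rewrite ?filter_uniq ?fset_uniq //.
  by rewrite map_inj_uniq ?enum_uniq //; apply: prodN_elems_inj.
move=> h; rewrite mem_filter; apply/andP/mapP => [[/asboolPn nsq hH]|[T]].
  have [s [us si hE]] := squarefree_prodN (H0 h hH) nsq.
  have sU f : f \in s -> f \in U.
    move=> fs; apply: (HU h) => //; first exact: si.
    by rewrite hE irr_dvd_prodN //; apply: si.
  have e : h = prodN (elems [set x : U | val x \in s]).
    rewrite hE; apply: prodN_perm; apply: uniq_perm => // [|f].
      exact: elems_uniq.
    apply/idP/mapP => [fs|[x]]; last by rewrite mem_enum inE => ? ->.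
    by exists [` sU f fs]%fset; rewrite // mem_enum inE.
  by exists [set x : U | val x \in s]; rewrite // mem_enum inE -e.
rewrite mem_enum inE => TH ->; split=> //; apply/asboolPn.
by apply: prodN_squarefree; [exact: elems_uniq | exact: elems_irr].
Qed.

End MobiusSum.

(** * Normalized polynomials of bounded degree *)

Section Degrees.
Variables (F : finFieldType) (k : nat).
Implicit Types (f g h : normpoly F k) (m n d : 'X_{1..k}).

Definition degN f := multideg (repr f).

Lemma mem_normset m f :
  (f \in fset_set (@normset F k m)) = (repr f != 0) && (degN f == m).
Proof.
rewrite in_fset_set; last exact: finite_normset.
by apply/idP/andP; [rewrite inE => -[? <-] | move=> [? /eqP e]; rewrite inE].
Qed.

Lemma mdeg_ltS m d : (d <= m)%MM -> (mdeg d < (mdeg m).+1)%N.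
Proof.
by move=> /mnm_lepP le; rewrite ltnS !mdegE leq_sum.
Qed.

(** The union runs over a finite type of tuples; by [mdeg_ltS] its bound on the total degree
    excludes no [d <= m]. *)
Definition normset_le m : {fset normpoly F k} :=
  \big[fsetU/fset0]_(d : 'X_{1..k < (mdeg m).+1} | (bmnm d <= m)%MM)
    fset_set (@normset F k d).

Lemma mem_normset_le m f :
  (f \in normset_le m) = (repr f != 0) && (degN f <= m)%MM.
Proof.
apply/bigfcupP/andP => [[d /andP[_ dm]]|[f0 le]].
  by rewrite mem_normset => /andP[-> /eqP ->].
exists (BMultinom (mdeg_ltS le)); first by rewrite mem_index_enum.
by rewrite mem_normset f0 /=.
Qed.

Lemma degN_prodN (s : seq (normpoly F k)) : all_irr s ->
  degN (prodN s) = (\sum_(f <- s) degN f)%MM.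
Proof.
rewrite /degN /prodN multideg_repr_pi; elim: s => [|f s IH] si.
  rewrite !big_nil; apply/mnmP => i.
  by rewrite mnmE mnm0E msupp1 big_seq1 mnm0E.
have si' : all_irr s by move=> g gs; apply: si; rewrite in_cons gs orbT.
rewrite !big_cons multidegM ?IH ?prod_irr_neq0 //.
by case: (si f (mem_head _ _)).
Qed.

End Degrees.

(** * Counting coprime pairs *)

Section Divisors.
Variables (F : finFieldType) (k : nat).
Implicit Types (f g h : normpoly F k) (m n d : 'X_{1..k}) (p q : {mpoly F[k]}).

Definition divN h f : bool := `[< mdvd (repr h) (repr f) >].

Definition mulN h f : normpoly F k := \pi_(normpoly F k) (repr h * repr f).

Lemma mulN_neq0 h f : repr h != 0 -> repr f != 0 -> repr (mulN h f) != 0.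
Proof. by move=> h0 f0; rewrite repr_pi_eq0 mulf_neq0. Qed.

Lemma degN_mulN h f : repr h != 0 -> repr f != 0 ->
  degN (mulN h f) = (degN h + degN f)%MM.
Proof. by move=> h0 f0; rewrite /degN multideg_repr_pi multidegM. Qed.

Lemma divN_mulN h f : divN h (mulN h f).
Proof.
by apply/asboolP/mdvd_pi_repr; rewrite mulrC; exists (repr f).
Qed.

Lemma mulN_inj h : repr h != 0 -> injective (mulN h).
Proof.
move=> h0 f g /eqmodP/assocP[c c0 e]; rewrite -[f]reprK -[g]reprK.
by apply: (pi_eq c0); apply: (mulfI h0); rewrite e scalerAr.
Qed.

Lemma divNP h f : repr f != 0 -> divN h f ->
  [/\ repr h != 0 & exists2 g, repr g != 0 & f = mulN h g].
Proof.
move=> f0 /asboolP[c ec]; move: (f0).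
rewrite ec mulf_eq0 negb_or => /andP[c0 h0].
split=> //; exists (\pi_(normpoly F k) c); first by rewrite repr_pi_eq0.
by rewrite /mulN mulrC pi_repr_mul -ec reprK.
Qed.

Lemma divN_deg h f : repr f != 0 -> divN h f -> (degN h <= degN f)%MM.
Proof.
by move=> f0 /(divNP f0)[h0 [g g0 ->]]; rewrite degN_mulN // lem_addr.
Qed.

(** [mulN h] maps the polynomials of degree [m - degN h] bijectively onto the multiples of [h] of
    degree [m]. The case distinction is needed because subtraction of tuples is truncated. *)
Lemma sum_multiples m h : repr h != 0 ->
  \sum_(f <- fset_set (@normset F k m)) (divN h f)%:R =
  if (degN h <= m)%MM then (Npoly F (m - degN h)%MM)%:Z else 0.
Proof.
move=> h0; case: ifP => hm; last first.
  rewrite big_seq big1 // => f; rewrite mem_normset => /andP[f0 /eqP fm].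
  by case E : (divN h f) => //; move: hm; rewrite -fm divN_deg.
rewrite /Npoly card_fset_sum1 (big_morph Posz PoszD (erefl _)).
under [LHS]eq_bigr do rewrite mulrb.
rewrite -big_mkcond -big_filter.
transitivity (\sum_(f <- [seq mulN h g |
  g <- fset_set (@normset F k (m - degN h)%MM)]) (1 : int)).
  apply: perm_big; apply: uniq_perm; rewrite ?filter_uniq ?fset_uniq //.
    by rewrite map_inj_uniq ?fset_uniq //; apply: mulN_inj.
  move=> f; rewrite mem_filter mem_normset; apply/idP/mapP.
    case/and3P=> hf f0 /eqP fm; have [_ [g g0 fE]] := divNP f0 hf.
    exists g => //.
    by rewrite mem_normset g0 -fm fE degN_mulN // addmC addmK eqxx.
  case=> g; rewrite mem_normset => /andP[g0 /eqP dg] ->.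
  by rewrite divN_mulN mulN_neq0 // degN_mulN // dg addmC submK ?eqxx.
by rewrite big_map.
Qed.

(** By induction [q] is [c] times the product over [s]; a new prime factor of [q] does not divide
    that product, so it divides [c]. *)
Lemma mdvd_prod_irr (s : seq (normpoly F k)) q : uniq s -> all_irr s ->
  (forall f, f \in s -> mdvd (repr f) q) -> mdvd (\prod_(f <- s) repr f) q.
Proof.
elim: s => [|f s IH] /= us si sq.
  by rewrite big_nil; exists q; rewrite mulr1.
case/andP: us => fs us.
have si' : all_irr s by move=> g gs; apply: si; rewrite in_cons gs orbT.
have [|c qE] := IH us si'.
  by move=> g gs; apply: sq; rewrite in_cons gs orbT.
have fi := si f (mem_head _ _); have [_ _ fP] := mirreducible_prime fi.
have := sq f (mem_head _ _); rewrite qE => /fP[[a ->]|].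
  by exists a; rewrite big_cons mulrA.
by move/(irr_dvd_prod si' fi); rewrite (negPf fs).
Qed.

(** A common divisor is nonzero because [f] is, so it is a unit or has a prime factor, which would
    be common too. *)
Lemma is_gcd1_no_irr f g : repr f != 0 ->
  is_gcd 1 (repr f) (repr g) <->
  (forall h, mirreducible (repr h) -> divN h f -> ~~ divN h g).
Proof.
move=> f0; split=> [[_ _ gcd1] h hi /asboolP hf|noh].
  apply/asboolPn => hg; case: (hi) => _ /negP hU _; apply: hU.
  by apply: divides_unit (gcd1 _ hf hg); rewrite unitr1.
split; first by exists (repr f); rewrite mulr1.
  by exists (repr g); rewrite mulr1.
move=> e ef eg; have e0 : e != 0.
  by case: ef => c E; apply: contra_neq f0 => e0; rewrite E e0 mulr0.
have [u [[|p s] [uU sP eE]]] := mpoly_factorization e0.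
  by rewrite eE big_nil mulr1; exists u^-1; rewrite mulVr.
have pi : mirreducible p by apply/prime_mirreducible/sP/mem_head.
have pe : mdvd p e.
  by exists (u * \prod_(q <- s) q); rewrite eE big_cons mulrCA mulrC.
have := noh _ (mirreducible_repr_pi pi).
have -> : divN (\pi_(normpoly F k) p) f.
  by apply/asboolP/mdvd_repr_pi; apply: divides_trans ef.
move/(_ isT)/asboolPn => []; apply/mdvd_repr_pi; exact: divides_trans eg.
Qed.

(** The range [normset_le F m] contains every divisor of [f], whatever the degree of [g]. *)
Lemma sum_mobius_common_divisors m f g : repr f != 0 -> degN f = m ->
  \sum_(h <- normset_le F m | divN h f && divN h g) mobius h =
  (`[< is_gcd 1 (repr f) (repr g) >])%:R :> int.
Proof.
move=> f0 fm.
pose H := [fset h in normset_le F m | divN h f && divN h g]%fset.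
pose U := [fset h in H | `[< mirreducible (repr h) >]]%fset.
have HE h : (h \in H) = divN h f && divN h g.
  rewrite !inE mem_normset_le /=; apply: andb_idl => /andP[hf _].
  by have [-> _] := divNP f0 hf; rewrite -fm divN_deg.
have UE h : h \in U <-> (divN h f && divN h g) /\ mirreducible (repr h).
  have -> : (h \in U) = (h \in H) && `[< mirreducible (repr h) >].
    by rewrite !inE.
  by rewrite HE; split=> [/andP[-> /asboolP]|[-> /asboolP]].
have Ui : all_irr U by move=> h /UE[].
have H0 h : h \in H -> repr h != 0.
  by rewrite HE => /andP[hf _]; have [] := divNP f0 hf.
have HU h x : h \in H -> mirreducible (repr x) -> mdvd (repr x) (repr h) ->
    x \in U.
  rewrite HE => /andP[/asboolP hf /asboolP hg] xi xh; apply/UE; split=> //.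
  by apply/andP; split; apply/asboolP; apply: divides_trans xh _.
transitivity (\sum_(h <- H) mobius h).
  rewrite -big_filter; apply: perm_big; apply: uniq_perm.
  - by rewrite filter_uniq ?fset_uniq.
  - exact: fset_uniq.
  - by move=> h; rewrite mem_filter !inE andbC.
rewrite (sum_mobius Ui H0 HU).
(* The condition on [T] always holds: a product of distinct common irreducible divisors divides both
   [f] and [g]. *)
rewrite (eq_bigl xpredT) ?sum_sign_sets; last first.
  have dvT (T : {set U}) q : (forall y : U, mdvd (repr (val y)) q) ->
      mdvd (repr (prodN (elems T))) q.
    move=> Uq; apply/mdvd_repr_pi/mdvd_prod_irr; first exact: elems_uniq.
      exact: elems_irr.
    by move=> _ /mapP[y _ ->].
  move=> T; rewrite HE; apply/andP; split; apply/asboolP; apply: dvT => y.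
    by case/UE: (valP y) => /andP[/asboolP].
  by case/UE: (valP y) => /andP[_ /asboolP].
congr (_%:R); congr nat_of_bool; apply/eqP/asboolP => [U0|].
  apply/is_gcd1_no_irr => // h hi hf; apply/negP => hg.
  have hU : h \in U by apply/UE; rewrite hf.
  by move: U0; apply/eqP; rewrite -lt0n; apply/card_gt0P; exists [` hU]%fset.
move/(is_gcd1_no_irr _ f0) => noh; apply: eq_card0 => x.
by case/UE: (valP x) => /andP[xf xg] xi; move: (noh _ xi xf); rewrite xg.
Qed.

Lemma Pcoprime_sum m n : (Pcoprime F m n)%:Z =
  \sum_(f <- fset_set (@normset F k m)) \sum_(g <- fset_set (@normset F k n))
    (`[< is_gcd 1 (repr f) (repr g) >])%:R.
Proof.
rewrite /Pcoprime card_fset_sum1 (big_morph Posz PoszD (erefl _)).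
transitivity (\sum_(x <- [seq (f, g) | f <- fset_set (@normset F k m),
    g <- fset_set (@normset F k n)])
    (`[< is_gcd 1 (repr x.1) (repr x.2) >])%:R : int);
  last by rewrite big_allpairs.
under [RHS]eq_bigr do rewrite mulrb.
rewrite -[RHS]big_mkcond -[RHS]big_filter; apply: perm_big; apply: uniq_perm.
- exact: fset_uniq.
- by rewrite filter_uniq // allpairs_uniq ?fset_uniq // => -[? ?] [? ?].
move=> [f g]; rewrite mem_filter in_fset_set; last first.
  apply: (@sub_finite_set _ _ (@normset F k m `*` @normset F k n)%classic).
    by move=> x [].
  by apply: finite_setX; apply: finite_normset.
have nE d h : (h \in fset_set (@normset F k d)) = `[< normset d h >].
  by rewrite in_fset_set //; exact: finite_normset.
apply/idP/andP => [|[/asboolP gcd1 /allpairsP[[f' g'] /= [fm gn [ef eg]]]]].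
  rewrite inE => -[fm gn gcd1]; split; first exact/asboolP.
  by apply/allpairsP; exists (f, g); split; rewrite //= nE; apply/asboolP.
subst f' g'; have nP d h : h \in fset_set (@normset F k d) -> normset d h.
  by rewrite nE => /asboolP.
by rewrite inE; split; [exact: nP | exact: nP | exact: gcd1].
Qed.

Lemma Apoly_sum_by_degree m n (G : 'X_{1..k} -> int) :
  \sum_(d : 'X_{1..k < (mdeg m).+1} | (bmnm d <= m)%MM && (bmnm d <= n)%MM)
     G d * Apoly F d =
  \sum_(h <- normset_le F m | (degN h <= n)%MM) G (degN h) * mobius h.
Proof.
have lt0 : (mdeg (0%MM : 'X_{1..k}) < (mdeg m).+1)%N by rewrite mdeg0.
(* The default value of [insubd] is never reached on [normset_le F m], by [pE]. *)
pose p h : 'X_{1..k < (mdeg m).+1} := insubd (BMultinom lt0) (degN h).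
have pE h : (degN h <= m)%MM -> bmnm (p h) = degN h.
  by move=> le; rewrite /p val_insubd mdeg_ltS.
rewrite [RHS]big_seq_cond.
rewrite (partition_big p
  (fun d : 'X_{1..k < (mdeg m).+1} =>
    (bmnm d <= m)%MM && (bmnm d <= n)%MM)) /=; last first.
  move=> h; rewrite mem_normset_le -andbA => /and3P[_ hm hn].
  by rewrite pE // hm.
apply: eq_bigr => d /andP[dm dn]; rewrite /Apoly mulr_sumr.
rewrite -[RHS]big_filter big_seq [RHS](perm_big (fset_set (@normset F k d))) /=.
  rewrite [RHS]big_seq; apply: eq_bigr => h.
  by rewrite mem_normset => /andP[_ /eqP ->].
apply: uniq_perm; rewrite ?filter_uniq ?fset_uniq // => h.
rewrite mem_filter mem_normset mem_normset_le.
apply/idP/andP => [/andP[/andP[/andP[/andP[h0 hm] hn] /eqP pd] _]|[h0 /eqP hd]].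
  by rewrite h0 -pd pE ?eqxx.
rewrite h0 hd dm dn /= andbT -val_eqE /=; apply/eqP.
by change (bmnm (p h) = bmnm d); rewrite pE ?hd.
Qed.

Theorem Pcoprime_formula m n : (Pcoprime F m n)%:Z =
    \sum_(d : 'X_{1..k < (mdeg m).+1} | (bmnm d <= m)%MM && (bmnm d <= n)%MM)
      (Npoly F (m - d)%MM)%:Z * (Npoly F (n - d)%MM)%:Z * Apoly F d.
Proof.
rewrite (Apoly_sum_by_degree _ _
  (fun d => (Npoly F (m - d)%MM)%:Z * (Npoly F (n - d)%MM)%:Z)).
rewrite Pcoprime_sum.
transitivity (\sum_(f <- fset_set (@normset F k m))
    \sum_(g <- fset_set (@normset F k n)) \sum_(h <- normset_le F m)
      (divN h f)%:R * (divN h g)%:R * mobius h).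
  rewrite big_seq [RHS]big_seq; apply: eq_bigr => f.
  rewrite mem_normset => /andP[f0 /eqP fm]; apply: eq_bigr => g _.
  rewrite -(sum_mobius_common_divisors _ f0 fm) [LHS]big_mkcond.
  by apply: eq_bigr => h _; rewrite -natrM mulnb -mulrb mulr_natl.
(* With [h] outermost, the sum over pairs becomes a product of two counts of multiples of [h]. *)
under eq_bigr do rewrite exchange_big /=.
rewrite exchange_big /= [RHS]big_mkcond big_seq [RHS]big_seq.
apply: eq_bigr => h; rewrite mem_normset_le => /andP[h0 hm].
under eq_bigr do rewrite -mulr_suml -mulr_sumr.
(* When [degN h <= n] fails, the second count is 0, in agreement with the filter in the target
   sum. *)
rewrite -mulr_suml -mulr_suml !sum_multiples // hm; case: ifP => // _.
by rewrite mulr0 mul0r.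
Qed.

(** A polynomial of multidegree zero has only a constant term, so it is zero or a unit. *)
Lemma multideg_irr p : mirreducible p -> multideg p != 0%MM.
Proof.
case=> p0 /negP pU _; apply/eqP => d0; apply: pU.
have pE : p = (p@_0%MM)%:MP.
  apply/mpolyP => t; rewrite mcoeffC; have [<-|t0] := eqVneq 0%MM t.
    by rewrite mulr1.
  rewrite mulr0 memN_msupp_eq0 //; apply: contra t0 => tp; apply/eqP/mnmP => i.
  apply/eqP; rewrite mnm0E eq_sym -leqn0.
  have := congr1 (fun t : 'X_{1..k} => t i) d0; rewrite mnmE mnm0E => <-.
  exact: leq_bigmax_seq.
rewrite pE mpolyC_unit //; apply: contra_neq p0 => c0.
by rewrite pE c0 mpolyC0.
Qed.

End Divisors.

(** [J] may be infinite: it will be the type of families of natural numbers, with [S] the finite set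
    of admissible ones. *)
Lemma partition_big_fset (R : nmodType) (I : finType) (J : choiceType)
    (p : I -> J) (S : {fset J}) (E : I -> R) :
  \sum_(i | p i \in S) E i = \sum_(a <- S) \sum_(i | p i == a) E i.
Proof.
rewrite [RHS]big_seq (exchange_big_dep (fun i => p i \in S)) /=; last first.
  by move=> a i aS /eqP ->.
apply: eq_bigr => i pS; rewrite big_mkcond (bigD1_seq (p i)) ?fset_uniq //=.
rewrite pS eqxx big1 ?addr0 // => a /negPf; rewrite eq_sym => ->.
by rewrite andbF.
Qed.

(** * Sorting sets of irreducibles by degree *)

Section Families.
Variables (F : finFieldType) (k : nat) (d : 'X_{1..k}).

Let U : {fset normpoly F k} :=
  [fset f in normset_le F d | `[< mirreducible (repr f) >]]%fset.

Let mem_U f : reflect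
  [/\ repr f != 0, (degN f <= d)%MM & mirreducible (repr f)] (f \in U).
Proof.
rewrite !inE /= mem_normset_le; apply: (iffP andP).
  by case=> /andP[f0 le] /asboolP.
by case=> f0 le /asboolP ->; rewrite f0 le.
Qed.

Lemma card_Ipoly (i : 'X_{1..k}) : (i <= d)%MM ->
  #|[set x : U | degN (val x) == i]| = Ipoly F i.
Proof.
move=> le; rewrite cardE /Ipoly -(size_map val); apply/perm_size/uniq_perm.
- by rewrite map_inj_uniq ?enum_uniq //; apply: val_inj.
- exact: fset_uniq.
move=> f; rewrite in_fset_set; last exact/finite_setIl/finite_normset.
apply/mapP/idP => [[x]|].
  rewrite mem_enum finset.in_set => /eqP xi ->.
  by have /mem_U[f0 _ fi] := valP x; apply/mem_set; split.
move=> /set_mem[[f0 fi] irr].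
have fU : f \in U by apply/mem_U; rewrite /degN fi.
by exists [` fU]%fset; rewrite // mem_enum inE /= /degN fi.
Qed.

(** Irreducibles are colored by their degree, a legitimate index because it is nonzero and at most
    [d]. *)
Lemma color_exists :
  exists c : U -> below d, forall x, below_mnm (c x) = degN (val x).
Proof.
suff /choice[c cE] (x : U) : exists i : below d, below_mnm i = degN (val x).
  by exists c.
have /mem_U[f0 le fi] := valP x.
have pos : (0 < bmnm (BMultinom (mdeg_ltS le)))%MM &&
    (bmnm (BMultinom (mdeg_ltS le)) <= d)%MM.
  rewrite /= le andbT /ltm eq_sym multideg_irr //=.
  by apply/mnm_lepP => i; rewrite mnm0E.
by exists (Sub (BMultinom (mdeg_ltS le)) pos); rewrite /below_mnm SubK.
Qed.

Theorem Apoly_formula : Apoly F d =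
  \sum_(a <- fset_set (families d))
    (-1) ^+ (\sum_(i : below d) a i)%N *
    \prod_(i : below d) ('C(Ipoly F (below_mnm i), a i))%:Z.
Proof.
have Ui : all_irr U by move=> f /mem_U[].
rewrite /Apoly (sum_mobius Ui); first last.
- move=> h f; rewrite mem_normset => /andP[h0 /eqP hd] fi fh; apply/mem_U.
  by split=> //; [case: fi | rewrite -hd; apply: divN_deg => //; apply/asboolP].
- by move=> h; rewrite mem_normset => /andP[].
have [c cE] := color_exists.
pose p (T : {set U}) : {ffun below d -> nat} :=
  [ffun i => #|[set x in T | c x == i]|].
(* Degrees add up under products, so the product over [T] has degree [d] exactly when the color
   counts of [T] form an admissible family. *)
have pE T : (prodN (elems T) \in fset_set (@normset F k d)) =
    (p T \in fset_set (families d)).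
  rewrite mem_normset prodN_neq0 ?degN_prodN /=; try exact: elems_irr.
  rewrite in_fset_set; last exact: finite_families.
  suff -> : (\sum_(f <- elems T) degN f = \sum_i below_mnm i *+ p T i)%MM.
    by apply/eqP/idP; rewrite inE.
  rewrite big_map big_enum /=; apply/mnmP => j; rewrite !mnm_sumE.
  rewrite (partition_big c xpredT) //=; apply: eq_bigr => i _.
  rewrite mulmnE ffunE (eq_bigr (fun=> below_mnm i j)).
    rewrite sum_nat_const mulnC; congr (_ * _)%N.
    by apply: eq_card => x; rewrite !inE.
  by move=> x /andP[_ /eqP <-]; rewrite cE.
rewrite (eq_bigl _ _ pE) partition_big_fset; apply: eq_bigr => a _.
rewrite (eq_bigr (fun=> (-1) ^+ (\sum_i a i)%N)); last first.
  move=> T /eqP <-; congr (_ ^+ _).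
  rewrite -sum1_card (partition_big c xpredT) //.
  apply: eq_bigr => i _; rewrite ffunE -sum1_card.
  by apply: eq_bigl => x; rewrite inE.
(* The sign is constant on the sets with color counts [a]; it remains to count these sets. *)
rewrite sumr_const -mulr_natr; congr (_ * _).
rewrite (eq_card (B := [set T : {set U} |
    [forall j, #|[set x in T | c x == j]| == a j]])); last first.
  move=> T; rewrite inE; transitivity (p T == a) => //.
  apply/eqP/forallP => [<- j|e].
    by rewrite ffunE.
  by apply/ffunP => j; rewrite ffunE; apply/eqP.
rewrite card_sets_by_color natr_prod; apply: eq_bigr => i _.
rewrite -natz -[in RHS]card_Ipoly; last by have /andP[] := valP i.
congr ('C(_, _)%:R); apply: eq_card => x; rewrite !inE -cE.
apply/eqP/eqP => [-> //|e]; do 2 apply: val_inj; exact: e.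
Qed.

End Families.

Theorem mainTheorem10 (F : finFieldType) (k : nat) (hk : (0 < k)%N)
    (m n : 'X_{1..k}) :
  (Pcoprime F m n)%:Z =
    \sum_(d : 'X_{1..k < (mdeg m).+1} | (d <= m)%MM && (d <= n)%MM)
      (Npoly F (m - d)%MM)%:Z * (Npoly F (n - d)%MM)%:Z * Apoly F d
  /\ forall d : 'X_{1..k},
      Apoly F d =
        \sum_(a <- fset_set (families d))
          (-1) ^+ (\sum_(i : below d) a i)%N *
          \prod_(i : below d) ('C(Ipoly F (below_mnm i), a i))%:Z.
Proof.
split; [exact: Pcoprime_formula | exact: Apoly_formula].
Qed.
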